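(* Consider the bottleneck model with a transit outside option, with parameters $\Lambda,\lambda,\mu,e,L,z_C,z_T$ (as described in the context), where $z_T\ge z_C\ge 0$. Suppose $\mu<\lambda$, and let $\tau_s^*$ be the static revenue-optimal toll, $\tau_d^*(\cdot)$ be the dynamic revenue-optimal toll, and $SC^*$ be the minimum achievable system cost. If $z_T - z_C \le \dfrac{\Lambda e L}{\mu(e+L)}$, then $$SC(\tau_d^*(\cdot)) \le 2\,SC^* \quad\text{and}\quad SC(\tau_s^* )\le 2\,SC^*.$$
   Context: Bottleneck model with outside option. A continuum of users of total mass $\Lambda>0$ has desired bottleneck crossing times $t^*$ uniformly distributed over $[t_1,t_2]$, with desired arrival rate $\lambda = \Lambda/(t_2-t_1)$. Each user travels either by car, through a deterministic first-in-first-out point-queue bottleneck with capacity (maximal service rate) $\mu>0$, or by public transit. All costs are normalized by the value of waiting time. A car user with desired crossing time $t^*$ who crosses the bottleneck at time $t$ pays $$c(t,t^* ) = z_C + w(t) + e\,(t^*-t)_+ + L\,(t-t^* )_+ + \tau(t),$$ where $z_C$ is the free-flow cost of a car trip, $w(t)\ge 0$ is the (endogenous) queuing delay of a vehicle crossing at time $t$ ($w(t)>0$ only when the bottleneck discharges at capacity), $0<e<1$ and $L>0$ are the earliness and lateness penalties, and $\tau(t)\ge 0$ is the toll for crossing at time $t$. A transit user pays the fixed cost $z_T$ and arrives at the desired time. A dynamic tolling policy is a (possibly time-varying) toll function $\tau(\cdot)$; a static toll is a constant one, $\tau(t)=\tau$ for all $t$. Equilibrium: given the toll, every user chooses a mode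 and, if traveling by car, a crossing time, so as to minimize own cost given $w(\cdot)$, and no user has an incentive to deviate; car users cross in order of their desired crossing times. When users are indifferent between car and transit, ties are broken in favor of higher-revenue outcomes. When $z_T \ge z_C$ and $\mu<\lambda$, car users cross at rate $\mu$ over an equilibrium interval $[t_A,t_D]$ (depending on the policy). Revenue: $R(\tau(\cdot))$ is the total toll paid by car users at the equilibrium induced by the policy; for $z_T\ge z_C$ and $\mu<\lambda$, $R(\tau(\cdot)) = \int_{t_A}^{t_D}\mu\,\tau(t)\,dt$. The static (respectively dynamic) revenue-optimal toll maximizes $R$ over all static tolls (respectively all dynamic tolling policies). System cost: $SC(\tau(\cdot))$ is the total cost of all users at the induced equilibrium excluding toll payments, that is $$SC(\tau(\cdot)) = \int_{t_1}^{t_2}\lambda\left[x_C(t^* )\big(c(t(t^* ),t^* )-\tau(t(t^* ))\big) + (1-x_C(t^* ))\,z_T\right]dt^*,$$ where $x_C(t^* )\in[0,1]$ is the equilibrium fraction of users with desired time $t^*$ who travel by car and $t(t^* )$ is the time at which such car users cross the bottleneck. The minimum achievable system cost $SC^*$ is the minimum of $SC(\tau(\cdot))$ over all dynamic tolling policies. *)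

(* Defs.v *)
From HB Require Import structures.
From mathcomp Require Import all_boot all_order all_algebra.
From mathcomp Require Import all_classical all_reals all_analysis.

Set Implicit Arguments.
Unset Strict Implicit.
Unset Printing Implicit Defensive.

Import Order.TTheory GRing.Theory Num.Theory.
Import numFieldNormedType.Exports.

Local Open Scope classical_set_scope.
Local Open Scope ring_scope.

(* Costs are in units of waiting time; [earl] and [late] are the penalties
   e and L, [zC] and [zT] the free-flow car cost and the transit cost. *)
Record bottleneck (R : realType) := Bottleneck {
  mass : R;
  t1 : R;
  t2 : R;
  capacity : R;
  earl : R;
  late : R;
  zC : R;
  zT : R }.

Definition arrival_rate (R : realType) (M : bottleneck R) : R :=
  mass M / (t2 M - t1 M).

Definition standing_assumptions (R : realType) (M : bottleneck R) : Prop :=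
  [/\ 0 < mass M, t1 M < t2 M, 0 < capacity M,
      0 < earl M < 1 & 0 < late M].

(* [desired M s]: s is the desired crossing time of some user. *)
Definition desired (R : realType) (M : bottleneck R) : set R :=
  `[t1 M, t2 M]%classic.

(* [queue t] is the delay of a vehicle crossing at [t] (its arrival time at the
   bottleneck is [t - queue t]); [rate t] is the rate at which cars cross at
   [t]; [share s] is the fraction of the users with desired time [s] who drive,
   and [cross s] the time at which those drivers cross.  [cross s] is
   meaningless when [share s = 0]. *)
Record outcome (R : realType) := Outcome {
  queue : R -> R;
  rate : R -> R;
  share : R -> R;
  cross : R -> R }.

Definition car_cost (R : realType) (M : bottleneck R) (tau w : R -> R)
    (t s : R) : R :=
  zC M + w t + earl M * Num.max (s - t) 0 + late M * Num.max (t - s) 0 + tau t.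

Record equilibrium (R : realType) (M : bottleneck R) (tau : R -> R)
    (o : outcome R) : Prop := Equilibrium {
  eq_share_meas : measurable_fun (desired M) (share o);
  eq_share_itv : forall s, desired M s -> 0 <= share o s <= 1;
  eq_cross_meas : measurable_fun (desired M) (cross o);
  eq_rate_meas : measurable_fun setT (rate o);
  eq_rate_itv : forall t, 0 <= rate o t <= capacity M;
  (* the mass of cars crossing during B is the mass of the drivers whose
     crossing time lies in B *)
  eq_flow : forall B : set R, measurable B ->
    (\int[lebesgue_measure]_(t in B) (rate o t)%:E =
     \int[lebesgue_measure]_(s in desired M `&` cross o @^-1` B)
        (arrival_rate M * share o s)%:E)%E;
  eq_queue_ge0 : forall t, 0 <= queue o t;
  (* a queue is present only while the bottleneck discharges at capacity *)
  eq_queue_capacity : forall t, 0 < queue o t -> rate o t = capacity M;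
  (* first in, first out: whoever crosses later arrived later *)
  eq_fifo : forall t t', t <= t' -> t - queue o t <= t' - queue o t';
  eq_order : forall s s', desired M s -> desired M s' ->
    0 < share o s -> 0 < share o s' -> s <= s' -> cross o s <= cross o s';
  eq_car : forall s, desired M s -> 0 < share o s ->
    (forall t, car_cost M tau (queue o) (cross o s) s
               <= car_cost M tau (queue o) t s) /\
    car_cost M tau (queue o) (cross o s) s <= zT M;
  eq_transit : forall s, desired M s -> share o s < 1 ->
    forall t, zT M <= car_cost M tau (queue o) t s }.

Definition revenue (R : realType) (M : bottleneck R) (tau : R -> R)
    (o : outcome R) : R :=
  \int[lebesgue_measure]_(s in desired M)
     (arrival_rate M * share o s * tau (cross o s)).

Definition system_cost (R : realType) (M : bottleneck R) (tau : R -> R)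
    (o : outcome R) : R :=
  \int[lebesgue_measure]_(s in desired M)
     (arrival_rate M *
        (share o s * (car_cost M tau (queue o) (cross o s) s - tau (cross o s))
         + (1 - share o s) * zT M)).

(* Ties are broken in favor of revenue: a toll induces the equilibria that have
   the highest revenue among all its equilibria.  A toll function without
   such an equilibrium induces nothing, and is ignored below. *)
Definition induced (R : realType) (M : bottleneck R) (tau : R -> R)
    (o : outcome R) : Prop :=
  equilibrium M tau o /\
  forall o', equilibrium M tau o' -> revenue M tau o' <= revenue M tau o.

Definition dynamic_tolls (R : realType) : set (R -> R) :=
  [set tau : R -> R | measurable_fun setT tau /\ forall t, 0 <= tau t].

Definition static_tolls (R : realType) : set (R -> R) :=
  [set tau : R -> R | exists2 c : R, 0 <= c & tau = cst c].

(* [tau], with induced equilibrium [o], maximizes revenue over [policies]. *)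
Definition revenue_optimal (R : realType) (M : bottleneck R)
    (policies : set (R -> R)) (tau : R -> R) (o : outcome R) : Prop :=
  [/\ policies tau, induced M tau o &
      forall tau' o', policies tau' -> induced M tau' o' ->
        revenue M tau' o' <= revenue M tau o].

Definition is_min_system_cost (R : realType) (M : bottleneck R) (m : R) : Prop :=
  (exists tau o, [/\ dynamic_tolls tau, induced M tau o &
                     system_cost M tau o = m]) /\
  (forall tau o, dynamic_tolls tau -> induced M tau o ->
     m <= system_cost M tau o).

(* Main.v *)
Require Import Defs.
From mathcomp Require Import all_boot all_order all_algebra.
From mathcomp Require Import all_classical all_reals all_analysis.
From mathcomp Require Import measurable_realfun ring lra.

(** The bottleneck is a transportation problem, and queueing delays are prices
    for its capacity.  Let G = zT - zC, T = t2 - t1, r = capacity / arrival rate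
    and K = (1 - r) (1/e + 1/L).  When a car trip is worth D, linear programming
    duality with a trapezoidal price of capacity shows that no outcome has a
    social value above V(D) = capacity * (D T + K D^2 / 2) (as long as the
    early and the late peak do not overlap, which is the bound on G).  Hence the
    minimum system cost is at least mass * zT - V(G).

    An equilibrium under the constant toll G - D is competitive, so it attains
    V(D); its number of drivers is then a subgradient of V at D, that is
    V'(D) = capacity * (T + K D).  All equilibria of that toll therefore have
    the same revenue, the trapezoidal one is induced, and any revenue-optimal
    toll, static or dynamic, collects at least (G - D) V'(D).  As each driver
    saves at least the toll compared with transit, the system cost is at most
    mass * zT minus the revenue, and it remains to choose D: zero if K G <= T,
    and (G - T / K) / 2 otherwise. *)

Set Implicit Arguments.
Unset Strict Implicit.
Unset Printing Implicit Defensive.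

Import Order.TTheory GRing.Theory Num.Theory.
Import numFieldNormedType.Exports.
Local Open Scope classical_set_scope.
Local Open Scope ring_scope.

(** * Densities, ramps and affine changes of variable *)

Section pushforward_density.
Import HBNNSimple.
Context d1 d2 (X : measurableType d1) (Y : measurableType d2) (R : realType).
Variables (mX : {measure set X -> \bar R}) (mY : {measure set Y -> \bar R}).
Variables (D : set X) (phi : X -> Y) (a : Y -> R) (b : X -> R).
Hypotheses (mD : measurable D) (mphi : measurable_fun D phi).
Hypotheses (ma : measurable_fun setT a) (mb : measurable_fun D b).
Hypotheses (a0 : forall y, 0 <= a y) (b0 : forall x, D x -> 0 <= b x).
Hypothesis ab : forall B, measurable B ->
  (\int[mY]_(y in B) (a y)%:E = \int[mX]_(x in D `&` phi @^-1` B) (b x)%:E)%E.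

(** A simple function is a finite combination of indicators of its level sets, and for the indicator
    of a measurable set the claim is the hypothesis [ab]. *)
Local Lemma integral_pushforward_density_nnsfun (h : {nnsfun Y >-> R}) :
  (\int[mY]_y (a y * h y)%:E = \int[mX]_(x in D) (b x * h (phi x))%:E)%E.
Proof.
under [LHS]eq_integral => y _.
  rewrite EFinM fimfunE -fsumEFin// ge0_mule_fsumr; last first.
    by move=> r; rewrite EFinM nnfun_muleindic_ge0.
  over.
under [RHS]eq_integral => x _.
  rewrite EFinM fimfunE -fsumEFin// ge0_mule_fsumr; last first.
    by move=> r; rewrite EFinM nnfun_muleindic_ge0.
  over.
rewrite ge0_integral_fsum//=; last 2 first.
  - move=> r; apply: emeasurable_funM; first exact/measurable_EFinP.
    by apply/measurable_EFinP/measurableT_comp.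
  - by move=> r y _; rewrite mule_ge0 ?lee_fin ?a0// -lee_fin EFinM nnfun_muleindic_ge0.
rewrite ge0_integral_fsum//=; last 2 first.
  - move=> r; apply: emeasurable_funM; first exact/measurable_EFinP.
    apply/measurable_EFinP; apply: measurableT_comp => //=.
    exact: (measurableT_comp (measurable_indic _)).
  - move=> r x Dx; rewrite mule_ge0 ?lee_fin ?b0//.
    by rewrite -lee_fin EFinM nnfun_muleindic_ge0.
apply: eq_fsbigr => r _.
have mB : measurable (h @^-1` [set r]) by [].
under eq_integral do rewrite EFinM muleCA.
under [RHS]eq_integral do rewrite EFinM muleCA.
(* Negative levels have empty preimages, so only nonnegative constants have to be pulled out of the
   integrals. *)
have [r0|r0] := ltP r 0.
  rewrite preimage_nnfun0// !integral0_eq// => z _;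
  by rewrite indicE in_set0 mule0 mule0.
rewrite ge0_integralZl//; last 2 first.
  - apply: emeasurable_funM; first exact/measurable_EFinP.
    exact/measurable_EFinP.
  - by move=> y _; rewrite mule_ge0 ?lee_fin.
rewrite ge0_integralZl//; last 2 first.
  - apply: emeasurable_funM; first exact/measurable_EFinP.
    by apply/measurable_EFinP/measurableT_comp.
  - by move=> y Dy; rewrite mule_ge0 ?lee_fin// b0.
congr (_ * _)%E.
transitivity (\int[mY]_(y in h @^-1` [set r]) (a y)%:E)%E.
  rewrite [RHS]integral_mkcond; apply: eq_integral => y _.
  by rewrite patchE indicE; case: ifP; rewrite ?mule1 ?mule0.
rewrite ab// integral_mkcondr; apply: eq_integral => x _.
rewrite patchE indicE (_ : (x \in phi @^-1` _) = (phi x \in h @^-1` [set r]))//.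
by case: ifP => _; rewrite ?mule1 ?mule0.
Qed.

(** Change of variables along [phi], by monotone convergence from simple functions. With [phi] the
    crossing time, it turns flow conservation, which is stated for sets, into an identity for
    weights such as prices and queueing delays. *)
Lemma integral_pushforward_density (f : Y -> R) :
  measurable_fun setT f -> (forall y, 0 <= f y) ->
  (\int[mY]_y (a y * f y)%:E = \int[mX]_(x in D) (b x * f (phi x))%:E)%E.
Proof.
move=> mf f0; have mf' : measurable_fun setT (EFin \o f) by exact/measurable_EFinP.
pose g := nnsfun_approx measurableT mf'.
have gf y : (g n y)%:E @[n --> \oo] --> (f y)%:E.
  by apply: (cvg_nnsfun_approx measurableT mf') => // z _; rewrite lee_fin.
have ndg m n y : (m <= n)%N -> g m y <= g n y.
  by move=> mn; exact/lefP/nd_nnsfun_approx.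
transitivity (limn (fun n => \int[mY]_y (a y * g n y)%:E))%E.
  rewrite -monotone_convergence//=.
  - apply: eq_integral => y _; apply/esym/cvg_lim => //.
    by under eq_fun do rewrite EFinM; rewrite EFinM; exact: cvgeZl.
  - by move=> n; apply/measurable_EFinP/measurable_funM.
  - by move=> n y _; rewrite lee_fin mulr_ge0.
  - by move=> y _ m n mn; rewrite lee_fin ler_wpM2l// ndg.
under eq_fun do rewrite integral_pushforward_density_nnsfun.
rewrite -monotone_convergence//=.
- apply: eq_integral => x _; apply/cvg_lim => //.
  by under eq_fun do rewrite EFinM; rewrite EFinM; exact: cvgeZl.
- move=> n; apply/measurable_EFinP/measurable_funM => //.
  exact: measurableT_comp.
- by move=> n x Dx; rewrite lee_fin mulr_ge0// b0.
- by move=> x Dx m n mn; rewrite lee_fin ler_wpM2l ?ndg// b0.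
Qed.

End pushforward_density.

(** Case analysis that yields value and sign together, so that goals about positive parts become
    linear. *)
Lemma pos_partP {R : realType} (x : R) :
  (Num.max x 0 = 0 /\ x <= 0) \/ (Num.max x 0 = x /\ 0 <= x).
Proof. by case: (leP x 0) => h; [left|right; rewrite ltW]. Qed.

Section ramps.
Context (R : realType).
Implicit Types a b c p q : R.
Notation mu := (@lebesgue_measure R).

Lemma bounded_integrable_itv a b (k : R) (f : R -> R) :
  measurable_fun `[a, b] f -> (forall x, x \in `[a, b] -> `|f x| <= k) ->
  mu.-integrable `[a, b] (EFin \o f).
Proof.
move=> mf fk; apply: measurable_bounded_integrable => //.
  by rewrite /= lebesgue_measure_itv/= -EFinB; case: ifP => _; rewrite ltry.
exists k; split; first by rewrite num_real.
by move=> M kM x/= xab; rewrite (le_trans (fk _ xab))// ltW.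
Qed.

Lemma Rintegral_affine a b p q : a <= b ->
  \int[mu]_(x in `[a, b]) (p + q * x) = p * (b - a) + q * (b ^+ 2 - a ^+ 2) / 2.
Proof.
(* The fundamental theorem of calculus is applied on nondegenerate intervals only. *)
rewrite le_eqVlt => /predU1P[<-|ab].
  by rewrite set_itv1 Rintegral_set1 !subrr mulr0 mulr0 mul0r addr0.
pose F (x : R) := p * x + q / 2 * x ^+ 2.
have dF (x : R) : is_derive x 1 F (p + q * x).
  by rewrite /F; apply: is_derive_eq; rewrite !scaler1/= /GRing.scale/=; field.
have cF : continuous F.
  by move=> x; apply: differentiable_continuous; apply/derivable1_diffP.
rewrite /Rintegral (@continuous_FTC2 _ _ F)//=.
- by rewrite /F; field.
- apply: continuous_subspaceT => x; apply: cvgD; first exact: cvg_cst.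
  by apply: cvgM; [exact: cvg_cst|exact: cvg_id].
- split; first by move=> x _; have [] := dF x.
  + exact/cvg_at_right_filter/cF.
  + exact/cvg_at_left_filter/cF.
- by move=> x _; rewrite derive1E derive_val.
Qed.

Lemma Rintegral_ramp_left a b c : a <= c <= b ->
  \int[mu]_(x in `[a, b]) Num.max (c - x) 0 = (c - a) ^+ 2 / 2.
Proof.
move=> /andP[ac cb].
transitivity (\int[mu]_(x in `[a, c]) (c + -1 * x)).
  rewrite Rintegral_mkcond [RHS]Rintegral_mkcond; apply: eq_Rintegral => x _.
  rewrite !patchE !mem_setE !in_itv/=.
  by case: (pos_partP (c - x)) => -[-> ?]; case: (leP a x) => ?; case: (leP x b) => ?;
    (try case: (leP x c) => ?); (try case: (leP c x) => ?) => //=; lra.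
by rewrite Rintegral_affine//; field.
Qed.

Lemma Rintegral_ramp_right a b c : a <= c <= b ->
  \int[mu]_(x in `[a, b]) Num.max (x - c) 0 = (b - c) ^+ 2 / 2.
Proof.
move=> /andP[ac cb].
transitivity (\int[mu]_(x in `[c, b]) (- c + 1 * x)).
  rewrite Rintegral_mkcond [RHS]Rintegral_mkcond; apply: eq_Rintegral => x _.
  rewrite !patchE !mem_setE !in_itv/=.
  by case: (pos_partP (x - c)) => -[-> ?]; case: (leP a x) => ?; case: (leP x b) => ?;
    (try case: (leP x c) => ?); (try case: (leP c x) => ?) => //=; lra.
by rewrite Rintegral_affine//; field.
Qed.

(** Both [surplus] and the part of [price] below its plateau have this shape. *)
Lemma Rintegral_two_ramps a b c d (k l : R) : a <= c <= b -> a <= d <= b ->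
  let f x := k * Num.max (c - x) 0 + l * Num.max (x - d) 0 in
  mu.-integrable `[a, b] (EFin \o f) /\
  \int[mu]_(x in `[a, b]) f x = k * ((c - a) ^+ 2 / 2) + l * ((b - d) ^+ 2 / 2).
Proof.
move=> acb adb f.
have mramp (g : R -> R) : measurable_fun setT g ->
    measurable_fun `[a, b] (fun x => Num.max (g x) 0).
  by move=> mg; apply: measurable_funTS; exact: measurable_maxr.
pose f1 x := k * Num.max (c - x) 0; pose f2 x := l * Num.max (x - d) 0.
have ml : measurable_fun `[a, b] (fun x => Num.max (c - x) 0).
  by apply: mramp; exact: measurable_funB.
have mr : measurable_fun `[a, b] (fun x => Num.max (x - d) 0).
  by apply: mramp; exact: measurable_funB.
have bl x : x \in `[a, b] -> `|Num.max (c - x) 0| <= c - a.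
  rewrite in_itv/= => /andP[ax xb]; rewrite ger0_norm ?le_max ?lexx ?orbT//.
  by case: (pos_partP (c - x)) => -[-> ?]; lra.
have br x : x \in `[a, b] -> `|Num.max (x - d) 0| <= b - d.
  rewrite in_itv/= => /andP[ax xb]; rewrite ger0_norm ?le_max ?lexx ?orbT//.
  by case: (pos_partP (x - d)) => -[-> ?]; lra.
have i1 : mu.-integrable `[a, b] (EFin \o f1).
  apply: (@bounded_integrable_itv _ _ (`|k| * (c - a))).
    exact: measurable_funM.
  by move=> x xab; rewrite normrM ler_wpM2l ?bl.
have i2 : mu.-integrable `[a, b] (EFin \o f2).
  apply: (@bounded_integrable_itv _ _ (`|l| * (b - d))).
    exact: measurable_funM.
  by move=> x xab; rewrite normrM ler_wpM2l ?br.
split; first exact: (integrableD _ i1 i2).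
rewrite (RintegralD _ i1 i2)// !RintegralZl//.
- by rewrite Rintegral_ramp_left// Rintegral_ramp_right.
- exact: bounded_integrable_itv mr br.
- exact: bounded_integrable_itv ml bl.
Qed.

End ramps.

(** By uniqueness of Lebesgue measure: [k] times its image under the affine map has the right value
    on half-open intervals. *)
Lemma lebesgue_measure_affine (R : realType) (k c : R) (A : set R) :
  0 < k -> measurable A ->
  (lebesgue_measure ((fun x => k * x + c)%R @^-1` A) =
   k^-1%:E * lebesgue_measure A)%E.
Proof.
move=> k0 mA; pose phi (x : R) := k * x + c.
have mphi : measurable_fun [set: measurableTypeR R] (phi : _ -> measurableTypeR R).
  by apply: measurable_funD => //; exact: measurable_funM.
have -> : (lebesgue_measure A = k%:E * lebesgue_measure (phi @^-1` A))%E.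
  unshelve epose proof (@lebesgue_measure_unique R (mscale (NngNum (ltW k0))
    (@pushforward _ _ (measurableTypeR R) (measurableTypeR R) _
      lebesgue_measure phi))) as U; first exact: mphi.
  apply: U => //.
  move=> X /ocitvP[->|[[x y]/= xy ->]]; first by rewrite !measure0.
  rewrite /mscale/= /pushforward.
  have -> : phi @^-1` `]x, y] = `](x - c) / k, (y - c) / k]%classic.
    apply/seteqP; split => z/=; rewrite !in_itv/= /phi ltr_pdivrMr// ler_pdivlMr//; lra.
  rewrite !lebesgue_measure_itv/= !lte_fin ltr_pM2r ?invr_gt0// ltrD2r xy.
  by rewrite -!EFinB -EFinM; congr EFin; field; rewrite gt_eqF.
by rewrite muleA -EFinM mulVf ?mul1e// gt_eqF.
Qed.

(** * The trapezoidal outcome *)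

Section Trapezoid.
Context {R : realType} (M : bottleneck R).
Implicit Types D s t : R.

Definition ratio : R := capacity M / arrival_rate M.
Definition slope_sum : R := (earl M)^-1 + (late M)^-1.
(** The users with desired times before [early_end D] all drive. They number
    [capacity M * D / earl M], which fills the bottleneck exactly while the price climbs from 0 to
    [D] at slope [earl M]. The late side is symmetric. *)
Definition early_end D : R := t1 M + ratio * D / earl M.
Definition late_start D : R := t2 M - ratio * D / late M.
Definition first_car D : R := early_end D - D / earl M.
Definition last_car D : R := late_start D + D / late M.

Definition delay_cost t s : R :=
  earl M * Num.max (s - t) 0 + late M * Num.max (t - s) 0.
(* The optimal dual price of capacity when a car trip is worth [D]: it rises
   with slope [earl M], stays at [D], and falls with slope [late M]. *)
Definition price D t : R :=
  Num.max (D - (earl M * Num.max (early_end D - t) 0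
                + late M * Num.max (t - late_start D) 0)) 0.
(** The dual variable of the constraint that the share of drivers is at most 1: the rent of a user
    with desired time [s] at the prices [price D]. *)
Definition surplus D s : R :=
  earl M * Num.max (early_end D - s) 0 + late M * Num.max (s - late_start D) 0.

(* The equilibrium of the constant toll [zT M - zC M - D].  Users with desired
   times in [early_end D, late_start D] are indifferent to transit; all the
   others drive and cross early, respectively late, at capacity.  The ratio
   makes exactly enough drivers to keep the bottleneck busy. *)
Definition trapezoid_outcome D : outcome R := {|
  queue := price D;
  rate := fun t => if first_car D <= t <= last_car D then capacity M else 0;
  share := fun s => if early_end D <= s <= late_start D then ratio else 1;
  cross := fun s =>
    if s < early_end D then ratio^-1 * s + (first_car D - ratio^-1 * t1 M)
    else if s <= late_start D then s
    else ratio^-1 * s + (late_start D - ratio^-1 * late_start D) |}.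

Hypotheses (hM : standing_assumptions M) (hcap : capacity M < arrival_rate M).

Lemma earl_gt0 : 0 < earl M. Proof. by case: hM => _ _ _ /andP[]. Qed.
Lemma late_gt0 : 0 < late M. Proof. by case: hM. Qed.
Lemma capacity_gt0 : 0 < capacity M. Proof. by case: hM. Qed.
Lemma arrival_rate_gt0 : 0 < arrival_rate M.
Proof. exact: lt_trans capacity_gt0 hcap. Qed.
Lemma ratio_gt0 : 0 < ratio.
Proof. by rewrite divr_gt0 ?capacity_gt0 ?arrival_rate_gt0. Qed.
Lemma ratio_lt1 : ratio < 1.
Proof. by rewrite ltr_pdivrMr ?arrival_rate_gt0// mul1r. Qed.
Lemma arrival_rate_ratio : arrival_rate M * ratio = capacity M.
Proof. by rewrite mulrC divfK// gt_eqF// arrival_rate_gt0. Qed.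
Lemma mass_arrival : arrival_rate M * (t2 M - t1 M) = mass M.
Proof. by rewrite divfK// subr_eq0 gt_eqF//; case: hM. Qed.

Lemma delay_cost_ge0 t s : 0 <= delay_cost t s.
Proof.
by rewrite addr_ge0// mulr_ge0 ?(ltW earl_gt0) ?(ltW late_gt0)// le_max lexx orbT.
Qed.

Lemma price_ge0 D t : 0 <= price D t.
Proof. by rewrite le_max lexx orbT. Qed.

Lemma surplus_ge0 D s : 0 <= surplus D s.
Proof.
by rewrite addr_ge0// mulr_ge0 ?(ltW earl_gt0) ?(ltW late_gt0)// le_max lexx orbT.
Qed.

Lemma ler_pos_partD (k x y z : R) : 0 <= k -> z <= x + y ->
  k * Num.max z 0 <= k * Num.max x 0 + k * Num.max y 0.
Proof.
move=> k0 zxy; rewrite -mulrDr ler_wpM2l//.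
case: (pos_partP x) => -[-> ?]; case: (pos_partP y) => -[-> ?];
  case: (pos_partP z) => -[-> ?]; lra.
Qed.

(** Dual feasibility: rent and price together cover the value of letting user [s] cross at [t].
    Positive parts are subadditive, so moving from [s] to [t] raises the ramps by at most the
    schedule delay. *)
Lemma price_dual D t s : D - delay_cost t s - price D t <= surplus D s.
Proof.
have := @ler_pos_partD (earl M) (early_end D - s) (s - t) (early_end D - t)
  (ltW earl_gt0).
have := @ler_pos_partD (late M) (s - late_start D) (t - s) (t - late_start D)
  (ltW late_gt0).
rewrite /price /delay_cost /surplus.
set A := late M * _; set B := late M * _; set C := late M * _.
set A' := earl M * _; set B' := earl M * _; set C' := earl M * _.
move=> /(_ ltac:(lra)) h1 /(_ ltac:(lra)) h2.
by case: (pos_partP (D - (A' + A))) => -[-> ?]; lra.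
Qed.

(** Only the early ramp makes the price increase. Since [earl M < 1], this yields the
    first-in-first-out property when the price is used as queueing delay. *)
Lemma price_lipschitz D t t' : t <= t' ->
  price D t' - price D t <= earl M * (t' - t).
Proof.
move=> tt'; have e0 := earl_gt0.
have h0 : 0 <= earl M * (t' - t) by rewrite mulr_ge0 ?(ltW e0)// subr_ge0.
have := @ler_pos_partD (earl M) (early_end D - t') (t' - t) (early_end D - t)
  (ltW e0) ltac:(lra).
have : late M * Num.max (t - late_start D) 0 <=
       late M * Num.max (t' - late_start D) 0.
  rewrite ler_wpM2l ?(ltW late_gt0)//.
  case: (pos_partP (t - late_start D)) => -[-> ?];
  case: (pos_partP (t' - late_start D)) => -[-> ?]; lra.
rewrite /price (max_l (_ : 0 <= t' - t)); last lra.
set A := late M * _; set B := late M * _; set A' := earl M * _; set B' := earl M * _.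
move=> h1 h2.
case: (pos_partP (D - (A' + A))) => -[-> ?];
  case: (pos_partP (D - (B' + B))) => -[-> ?]; lra.
Qed.

Section gap.
Variable D : R.
Hypotheses (D0 : 0 <= D)
  (gapD : ratio * D * slope_sum <= t2 M - t1 M).

Let De0 : 0 <= D / earl M. Proof. by rewrite divr_ge0// ltW// earl_gt0. Qed.
Let Dl0 : 0 <= D / late M. Proof. by rewrite divr_ge0// ltW// late_gt0. Qed.
Let rDe0 : 0 <= ratio * D / earl M.
Proof. by rewrite -mulrA mulr_ge0// ltW// ratio_gt0. Qed.
Let rDl0 : 0 <= ratio * D / late M.
Proof. by rewrite -mulrA mulr_ge0// ltW// ratio_gt0. Qed.
Lemma early_end_late_start : early_end D <= late_start D.
Proof. by move: gapD; rewrite /early_end /late_start /slope_sum mulrDr; lra. Qed.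

Lemma first_car_le : first_car D <= early_end D.
Proof. by have := De0; rewrite /first_car; lra. Qed.

Lemma le_last_car : late_start D <= last_car D.
Proof. by have := Dl0; rewrite /last_car; lra. Qed.

Lemma t1_early_end : t1 M <= early_end D.
Proof. by have := rDe0; rewrite /early_end; lra. Qed.

Lemma late_start_t2 : late_start D <= t2 M.
Proof. by have := rDl0; rewrite /late_start; lra. Qed.

Lemma price_supp t : first_car D <= t <= last_car D \/ price D t = 0.
Proof.
have [ft|tf] := leP (first_car D) t; last first.
  right; rewrite /price (max_l (_ : 0 <= early_end D - t)); last first.
    by have := first_car_le; lra.
  rewrite max_r//.
  have : D <= earl M * (early_end D - t).
    rewrite -[leLHS](@divfK _ (earl M)) ?gt_eqF ?earl_gt0// mulrC.
    by rewrite ler_wpM2l ?(ltW earl_gt0)//; rewrite /first_car in tf; lra.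
  have : 0 <= late M * Num.max (t - late_start D) 0.
    by rewrite mulr_ge0 ?(ltW late_gt0)// le_max lexx orbT.
  lra.
have [tl|lt] := leP t (last_car D); first by left.
right; rewrite /price (max_l (_ : 0 <= t - late_start D)); last first.
  by have := le_last_car; lra.
rewrite max_r//.
have : D <= late M * (t - late_start D).
  rewrite -[leLHS](@divfK _ (late M)) ?gt_eqF ?late_gt0// mulrC.
  by rewrite ler_wpM2l ?(ltW late_gt0)//; rewrite /last_car in lt; lra.
have : 0 <= earl M * Num.max (early_end D - t) 0.
  by rewrite mulr_ge0 ?(ltW earl_gt0)// le_max lexx orbT.
lra.
Qed.

(** Between the first and the last car neither ramp exceeds [D], and the two ramps are never
    positive together because the peaks do not overlap. *)
Lemma priceE t : first_car D <= t <= last_car D ->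
  price D t = D - (earl M * Num.max (early_end D - t) 0
                   + late M * Num.max (t - late_start D) 0).
Proof.
move=> /andP[ft tl]; rewrite /price max_l// subr_ge0.
have := early_end_late_start.
have : earl M * (early_end D - t) <= D.
  rewrite -[leRHS](@divfK _ (earl M)) ?gt_eqF ?earl_gt0// [leRHS]mulrC.
  by rewrite ler_wpM2l ?(ltW earl_gt0)//; rewrite /first_car in ft; lra.
have : late M * (t - late_start D) <= D.
  rewrite -[leRHS](@divfK _ (late M)) ?gt_eqF ?late_gt0// [leRHS]mulrC.
  by rewrite ler_wpM2l ?(ltW late_gt0)//; rewrite /last_car in tl; lra.
case: (pos_partP (early_end D - t)) => -[-> ?];
  case: (pos_partP (t - late_start D)) => -[-> ?] ? ? ?;
  rewrite ?(mulr0, addr0, add0r) //.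
by rewrite (_ : early_end D - t = 0) ?mulr0 ?add0r//; lra.
Qed.

(* Complementary slackness: drivers of the trapezoid outcome cross at the times
   where the inequality [price_dual] is tight. *)
Lemma cross_surplus s : desired M s ->
  let t := cross (trapezoid_outcome D) s in
  first_car D <= t <= last_car D /\
  D - delay_cost t s - price D t = surplus D s.
Proof.
rewrite /desired/= in_itv/= => /andP[t1s st2].
have r0 := ratio_gt0; have r1 := ratio_lt1; have e0 := earl_gt0.
have l0 := late_gt0.
have H1 := early_end_late_start; have H2 := t1_early_end.
have H3 := late_start_t2; have H4 := first_car_le; have H5 := le_last_car.
have rV : 1 < ratio^-1 by rewrite invf_gt1.
case: (ltP s (early_end D)) => [s_lt|s_ge].
  set t := ratio^-1 * s + _.
  have tE : t = first_car D + ratio^-1 * (s - t1 M) by rewrite /t; ring.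
  have k : ratio^-1 * (s - t1 M) <= D / earl M.
    by rewrite ler_pdivrMl// mulrA; rewrite /early_end in s_lt; lra.
  have k0 : 0 <= ratio^-1 * (s - t1 M) by rewrite mulr_ge0 ?invr_ge0 ?(ltW r0)// subr_ge0.
  have ts : t <= s.
    (* The early branch of [cross] fixes [early_end D] and has slope above 1, so the users of the
       early peak do not cross after their desired times. *)
    rewrite -subr_ge0; have -> : s - t = (ratio^-1 - 1) * (early_end D - s).
      rewrite tE /first_car /early_end; field.
      by rewrite gt_eqF//= gt_eqF.
    by rewrite mulr_ge0 ?subr_ge0 ?(ltW rV) ?(ltW s_lt).
  have tI : first_car D <= t <= last_car D.
    by rewrite /first_car in tE *; apply/andP; split; lra.
  split=> //; rewrite priceE// /delay_cost /surplus.
  rewrite (max_l (_ : 0 <= s - t)) ?(max_r (_ : t - s <= 0));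
    rewrite ?(max_l (_ : 0 <= early_end D - t)) ?(max_r (_ : t - late_start D <= 0))
      ?(max_l (_ : 0 <= early_end D - s)) ?(max_r (_ : s - late_start D <= 0));
    first ring; lra.
case: (leP s (late_start D)) => [s_le|s_gt].
  split; first by apply/andP; split; lra.
  rewrite priceE /delay_cost /surplus; last by apply/andP; split; lra.
  rewrite !subrr !max_r ?lexx; [ring|lra..].
set t := ratio^-1 * s + _.
have tE : t = late_start D + ratio^-1 * (s - late_start D) by rewrite /t; ring.
have k : ratio^-1 * (s - late_start D) <= D / late M.
  by rewrite ler_pdivrMl// mulrA; rewrite /late_start; lra.
have ts : s <= t.
  rewrite -subr_ge0; have -> : t - s = (ratio^-1 - 1) * (s - late_start D).
    by rewrite tE; ring.
  by rewrite mulr_ge0 ?subr_ge0 ?(ltW rV) ?(ltW s_gt).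
have tI : first_car D <= t <= last_car D.
  by rewrite /last_car; apply/andP; split; lra.
split=> //; rewrite priceE// /delay_cost /surplus.
rewrite (max_r (_ : s - t <= 0)) ?(max_l (_ : 0 <= t - s));
  rewrite ?(max_r (_ : early_end D - t <= 0)) ?(max_l (_ : 0 <= t - late_start D))
    ?(max_r (_ : early_end D - s <= 0)) ?(max_l (_ : 0 <= s - late_start D));
  first ring; lra.
Qed.

End gap.
End Trapezoid.

(** * The trapezoidal outcome is an equilibrium *)

Section TrapezoidEquilibrium.
Context {R : realType} (M : bottleneck R).
Hypotheses (hM : standing_assumptions M) (hcap : capacity M < arrival_rate M).

Lemma car_costE tau w t s :
  car_cost M tau w t s = zC M + w t + delay_cost M t s + tau t.
Proof. by rewrite /car_cost /delay_cost; ring. Qed.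

Lemma measurable_pos_part d (X : measurableType d) (A : set X) (f : X -> R) :
  measurable_fun A f -> measurable_fun A (fun x => Num.max (f x) 0).
Proof. by move=> mf; exact: measurable_maxr. Qed.

Lemma measurable_delay_cost (A : set R) (f : R -> R) :
  measurable_fun A f -> measurable_fun A (fun s => delay_cost M (f s) s).
Proof.
move=> mf; apply: measurable_funD; apply: measurable_funM => //;
  apply: measurable_pos_part; exact: measurable_funB.
Qed.

Lemma measurable_price D : measurable_fun setT (price M D).
Proof.
apply: measurable_pos_part; apply: measurable_funB => //.
by apply: measurable_funD; apply: measurable_funM => //;
  apply: measurable_pos_part; exact: measurable_funB.
Qed.

Lemma measurable_surplus D : measurable_fun setT (surplus M D).
Proof.
by apply: measurable_funD; apply: measurable_funM => //;
  apply: measurable_pos_part; exact: measurable_funB.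
Qed.

Section gap.
Variable D : R.
Hypotheses (D0 : 0 <= D) 
  (gapD : ratio M * D * slope_sum M <= t2 M - t1 M).
Local Notation o := (trapezoid_outcome M D).

Lemma measurable_trapezoid_share (A : set R) : measurable_fun A (share o).
Proof.
apply: measurable_funTS; apply: measurable_fun_ifT => //=.
by apply: measurable_and; exact: measurable_fun_ler.
Qed.

Lemma measurable_trapezoid_cross (A : set R) : measurable_fun A (cross o).
Proof.
apply: measurable_funTS; apply: measurable_fun_ifT => /=.
- exact: measurable_fun_ltr.
- by apply: measurable_funD => //; exact: measurable_funM.
- apply: measurable_fun_ifT => /=; first exact: measurable_fun_ler.
    exact: measurable_id.
  by apply: measurable_funD => //; exact: measurable_funM.
Qed.

Lemma measurable_trapezoid_rate (A : set R) : measurable_fun A (rate o).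
Proof.
apply: measurable_funTS; apply: measurable_fun_ifT => //=.
by apply: measurable_and; exact: measurable_fun_ler.
Qed.

Lemma integral_const_on (A : set R) (f : R -> R) (k : R) : measurable A ->
  (forall x, A x -> f x = k) ->
  (\int[lebesgue_measure]_(x in A) (f x)%:E = k%:E * lebesgue_measure A)%E.
Proof.
move=> mA fk; rewrite -integral_cst//.
by apply: eq_integral => x /set_mem /fk ->.
Qed.

(** In the peaks everybody drives and [cross] stretches time by [ratio^-1]; in between, [cross] is
    the identity and a fraction [ratio] drives. Either way cars cross at rate
    [arrival_rate M * ratio], which is the capacity. *)
Lemma trapezoid_flow (B : set R) : measurable B ->
  (\int[lebesgue_measure]_(t in B) (rate o t)%:E =
   \int[lebesgue_measure]_(s in desired M `&` cross o @^-1` B)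
      (arrival_rate M * share o s)%:E)%E.
Proof.
move=> mB.
have r0 := ratio_gt0 hM hcap; have lam0 := arrival_rate_gt0 hM hcap.
have H1 := early_end_late_start gapD.
have H2 := t1_early_end hM hcap D0; have H3 := late_start_t2 hM hcap D0.
have H4 := first_car_le hM D0; have H5 := le_last_car hM D0.
set b := early_end M D in H1 H2 H4 *; set c := late_start M D in H1 H3 H5 *.
set a := first_car M D in H4 *; set d := last_car M D in H5 *.
have rV0 : 0 < (ratio M)^-1 by rewrite invr_gt0.
pose f1 s := (ratio M)^-1 * s + (a - (ratio M)^-1 * t1 M).
pose f3 s := (ratio M)^-1 * s + (c - (ratio M)^-1 * c).
have f1t1 : f1 (t1 M) = a by rewrite /f1; ring.
have f1b : f1 b = b.
  rewrite /f1 /a /b /first_car /early_end; field.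
  by rewrite !gt_eqF//= earl_gt0.
have f3c : f3 c = c by rewrite /f3; ring.
have f3t2 : f3 (t2 M) = d.
  rewrite /f3 /d /c /last_car /late_start; field.
  by rewrite !gt_eqF//= late_gt0.
have f1le x y : (f1 x <= f1 y) = (x <= y) by rewrite /f1 lerD2r ler_pM2l.
have f3le x y : (f3 x <= f3 y) = (x <= y) by rewrite /f3 lerD2r ler_pM2l.
have f1lt x y : (f1 x < f1 y) = (x < y) by rewrite /f1 ltrD2r ltr_pM2l.
have f3lt x y : (f3 x < f3 y) = (x < y) by rewrite /f3 ltrD2r ltr_pM2l.
have mf1 : measurable_fun setT f1.
  by apply: measurable_funD => //; exact: measurable_funM.
have mf3 : measurable_fun setT f3.
  by apply: measurable_funD => //; exact: measurable_funM.
have mpre (f : R -> R) (C : set R) : measurable_fun setT f -> measurable C ->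
    measurable (f @^-1` C).
  by move=> mf mC; rewrite -[X in measurable X]setTI; exact: mf.
(* The crossing times in [B] are split into early peak, plateau and late peak; the half-open ends
   make the pieces disjoint. *)
pose B1 := B `&` `[a, b[; pose B2 := B `&` `[b, c]; pose B3 := B `&` `]c, d].
have mB1 : measurable B1 by exact: measurableI.
have mB2 : measurable B2 by exact: measurableI.
have mB3 : measurable B3 by exact: measurableI.
pose A1 := f1 @^-1` B1; pose A3 := f3 @^-1` B3.
have mA1 : measurable A1 by exact: mpre.
have mA3 : measurable A3 by exact: mpre.
have af1 s : (a <= f1 s) = (t1 M <= s) by rewrite -[RHS]f1le f1t1.
have f1b_lt s : (f1 s < b) = (s < b) by rewrite -[RHS]f1lt f1b.
have cf3 s : (c < f3 s) = (c < s) by rewrite -[RHS]f3lt f3c.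
have f3d s : (f3 s <= d) = (s <= t2 M) by rewrite -[RHS]f3le f3t2.
have cross1 s : s < b -> cross o s = f1 s by move=> sb; rewrite /= sb.
have cross2 s : b <= s <= c -> cross o s = s.
  by move=> /andP[bs sc]; rewrite /= ltNge bs/= sc.
have cross3 s : c < s -> cross o s = f3 s.
  by move=> cs; rewrite /= ltNge (le_trans H1 (ltW cs))/= leNgt cs.
have AE : desired M `&` cross o @^-1` B = A1 `|` (B2 `|` A3).
  apply/seteqP; split => s; rewrite /desired.
    move=> [ds]; rewrite /preimage/mkset.
    have /andP[t1s st2] : t1 M <= s <= t2 M by move: ds; rewrite /= in_itv.
    have [sb|bs] := ltP s b.
      rewrite cross1// => Bs; left; split => //.
      by change (f1 s \in `[a, b[); rewrite in_itv/= af1 f1b_lt t1s.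
    have [sc|cs] := leP s c.
      rewrite cross2 ?bs// => Bs; right; left; split => //.
      by change (s \in `[b, c]); rewrite in_itv/= bs.
    rewrite cross3// => Bs; right; right; split => //.
    by change (f3 s \in `]c, d]); rewrite in_itv/= cf3 f3d cs.
  rewrite /preimage/mkset; move=> [[Bs]|[[Bs]|[Bs]]].
  - change (f1 s \in `[a, b[ -> s \in `[t1 M, t2 M] /\ B (cross o s)).
    move=> Hs; have /andP[t1s sb] : t1 M <= s < b.
      by move: Hs; rewrite in_itv/= af1 f1b_lt.
    by rewrite cross1//; split => //; rewrite in_itv/= t1s/=; lra.
  - change (s \in `[b, c] -> s \in `[t1 M, t2 M] /\ B (cross o s)).
    rewrite [_ \in `[b, c]]in_itv => bsc; have /andP[bs sc] : b <= s <= c := bsc.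
    rewrite cross2//; split => //.
    by rewrite in_itv/=; apply/andP; split; lra.
  - change (f3 s \in `]c, d] -> s \in `[t1 M, t2 M] /\ B (cross o s)).
    move=> Hs; have /andP[cs st2] : c < s <= t2 M.
      by move: Hs; rewrite in_itv/= cf3 f3d.
    by rewrite cross3//; split => //; rewrite in_itv/=; apply/andP; split; lra.
have BE : B `&` `[a, d] = B1 `|` (B2 `|` B3).
  rewrite /B1 /B2 /B3 -!setIUr; congr (_ `&` _).
  apply/seteqP; split => s/=; rewrite !in_itv/=.
    move=> /andP[sa sd]; case: (ltP s b) => sb; first by left; rewrite sa.
    by right; case: (leP s c) => sc; [left|right].
  by move=> [|[]] /andP[? ?]; apply/andP; split; lra.
have dis (P Q : set R) (x : R) : P `<=` `]-oo, x] -> Q `<=` `]x, +oo[ -> 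
    [disjoint P & Q].
  move=> Px Qx; apply/disj_setPS => s [/Px + /Qx].
  by rewrite /= !in_itv/= andbT; lra.
have dis' (P Q : set R) (x : R) : P `<=` `]-oo, x[ -> Q `<=` `[x, +oo[ -> 
    [disjoint P & Q].
  move=> Px Qx; apply/disj_setPS => s [/Px + /Qx].
  by rewrite /= !in_itv/= andbT; lra.
have -> : (\int[lebesgue_measure]_(t in B) (rate o t)%:E =
           (capacity M)%:E * lebesgue_measure (B `&` `[a, d]))%E.
  rewrite -(integral_const_on (f := rate o)); first last.
  - by move=> t [_]/=; rewrite in_itv/= -/a -/d => ->.
  - exact: measurableI.
  rewrite integral_mkcondr; apply: eq_integral => t _; rewrite patchE.
  by rewrite mem_setE in_itv/= -/a -/d; case: ifP.
rewrite BE AE.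
have dB23 : [disjoint B2 & B3].
  apply: (dis _ _ c) => // s [_]/=; rewrite !in_itv/= ?andbT => /andP[//].
have dB1 : [disjoint B1 & B2 `|` B3].
  apply: (dis' _ _ b) => s.
  - by move=> [_]/=; rewrite !in_itv/= => /andP[].
  - by move=> [|] [_]/=; rewrite !in_itv/= andbT => /andP[]; lra.
have sA1 : A1 `<=` `]-oo, b[.
  by move=> s [_]/=; rewrite !in_itv/= -/(f1 s) f1b_lt => /andP[].
have sA3 : A3 `<=` `]c, +oo[.
  by move=> s [_]/=; rewrite !in_itv/= andbT -/(f3 s) cf3 => /andP[].
have dA23 : [disjoint B2 & A3].
  apply: (dis _ _ c) => // s [_]/=; rewrite !in_itv/= => /andP[//].
have dA1 : [disjoint A1 & B2 `|` A3].
  apply: (dis' _ _ b) => // s [[_]/=|/sA3/=]; rewrite !in_itv/= andbT.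
    by move=> /andP[].
  lra.
have mshare A : measurable_fun A (fun s => (arrival_rate M * share o s)%:E).
  apply/measurable_EFinP; apply: measurable_funM => //.
  exact: measurable_trapezoid_share.
have share0 s : (0 <= (arrival_rate M * share o s)%:E)%E.
  rewrite lee_fin mulr_ge0 ?(ltW lam0)//=.
  by case: ifP; rewrite ?(ltW r0).
rewrite ge0_integral_setU//; [|exact: measurableU|exact: mshare].
rewrite ge0_integral_setU//; last exact: mshare.
rewrite measureU//; [|exact: measurableU|exact/disj_set2P].
rewrite measureU//; last exact/disj_set2P.
rewrite (@integral_const_on A1 _ (arrival_rate M))//; last first.
  by move=> s /sA1/=; rewrite in_itv/= -/b => sb; rewrite leNgt sb/= mulr1.
rewrite (@integral_const_on A3 _ (arrival_rate M))//; last first.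
  move=> s /sA3/=; rewrite in_itv/= andbT -/c => sb.
  by rewrite (leNgt s) sb/= andbF mulr1.
rewrite (@integral_const_on B2 _ (capacity M))//; last first.
  by move=> s [_]/=; rewrite in_itv/= -/b -/c => ->; rewrite arrival_rate_ratio.
(* Preimages under slope [ratio^-1] are shorter by the factor [ratio], which turns the arrival rate
   into the capacity. *)
rewrite /A1 /A3 !lebesgue_measure_affine// invrK !muleA -!EFinM arrival_rate_ratio//.
by rewrite !ge0_muleDr//= ?adde_ge0.
Qed.

(** At this toll a trip costs [zT M] minus the left side of [price_dual]. The cost is therefore
    least where that inequality is tight, as it is at the crossing times of the drivers. Rents are
    nonnegative, so driving is never worse than transit, and they vanish on the plateau, the only
    place where some users take transit. *)
Lemma trapezoid_equilibrium :
  equilibrium M (cst (zT M - zC M - D)) o.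
Proof.
have r0 := ratio_gt0 hM hcap; have r1 := ratio_lt1 hM hcap.
have share01 s : 0 < share o s <= 1.
  by rewrite /=; case: ifP; rewrite ?ltr01 ?lexx ?r0 ?(ltW r1).
have costE t s : car_cost M (cst (zT M - zC M - D)) (price M D) t s =
    zT M - (D - delay_cost M t s - price M D t).
  by rewrite car_costE /=; ring.
split.
- exact: measurable_trapezoid_share.
- by move=> s _; have /andP[/ltW -> ->] := share01 s.
- exact: measurable_trapezoid_cross.
- exact: measurable_trapezoid_rate.
- by move=> t /=; case: ifP; rewrite lexx (ltW (capacity_gt0 hM)).
- exact: trapezoid_flow.
- by move=> t; exact: price_ge0.
- move=> t /=; case: (price_supp hM D0 t) => [->//|->].
  by rewrite ltxx.
- move=> t t' tt' /=.
  have := price_lipschitz hM D tt'.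
  have : earl M * (t' - t) <= t' - t.
    by case: hM => _ _ _ /andP[_ e1] _; rewrite ler_piMl ?subr_ge0// ltW.
  lra.
- move=> s s' _ _ _ _ ss' /=.
  have H1 := early_end_late_start gapD.
  have rV0 : 0 < (ratio M)^-1 by rewrite invr_gt0.
  have rss : (ratio M)^-1 * s <= (ratio M)^-1 * s' by rewrite ler_pM2l.
  have f1b : (ratio M)^-1 * early_end M D + (first_car M D - (ratio M)^-1 * t1 M)
             = early_end M D.
    rewrite /first_car /early_end; field.
    by rewrite !gt_eqF//= earl_gt0.
  case: (ltP s (early_end M D)) => sb.
    have : (ratio M)^-1 * s <= (ratio M)^-1 * early_end M D.
      by rewrite ler_pM2l// ltW.
    case: (ltP s' (early_end M D)) => sb'; first lra.
    case: (leP s' (late_start M D)) => sc'; first lra.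
    have : (ratio M)^-1 * late_start M D <= (ratio M)^-1 * s'.
      by rewrite ler_pM2l// ltW.
    lra.
  rewrite ltNge (le_trans sb ss')/=.
  case: (leP s (late_start M D)) => sc.
    case: (leP s' (late_start M D)) => sc'; first by [].
    have : (ratio M)^-1 * late_start M D <= (ratio M)^-1 * s'.
      by rewrite ler_pM2l// ltW.
    lra.
  by rewrite (leNgt s') (lt_le_trans sc ss')/=; lra.
- move=> s ds _; have [_ csE] := cross_surplus hM hcap D0 gapD ds.
  split=> [t|]; rewrite [queue o]/=.
    by rewrite !costE csE; have := price_dual hM D t s; lra.
  by rewrite costE csE; have := surplus_ge0 hM D s; lra.
- move=> s ds /=; case: ifPn => [/andP[bs sc] _|_]; last by rewrite ltxx.
  move=> t; rewrite costE; have := price_dual hM D t s.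
  rewrite /surplus (max_r (_ : early_end M D - s <= 0)) ?subr_le0//.
  rewrite (max_r (_ : s - late_start M D <= 0)) ?subr_le0//.
  by rewrite !mulr0; lra.
Qed.

End gap.
End TrapezoidEquilibrium.

(** * Welfare and duality *)

Lemma measurable_desired (R : realType) (M : bottleneck R) :
  measurable (desired M).
Proof. exact: measurable_itv. Qed.
(* [lebesgue_measure] lives on [measurableTypeR R], which is convertible but not
   syntactically equal to [R]; both forms show up as side conditions. *)
#[local] Hint Extern 0 (measurable (desired _)) =>
  exact: measurable_desired : core.
#[local] Hint Extern 0 (@measurable _ (measurableTypeR _) (desired _)) =>
  exact: measurable_desired : core.

Section Welfare.
Context {R : realType} (M : bottleneck R).
Hypotheses (hM : standing_assumptions M) (hcap : capacity M < arrival_rate M).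
Local Notation leb := (@lebesgue_measure R).

Definition max_welfare (D : R) : R :=
  capacity M * D * (t2 M - t1 M)
  + capacity M * ((1 - ratio M) * slope_sum M) * D ^+ 2 / 2.

Definition drivers (o : outcome R) : R :=
  \int[leb]_(s in desired M) (arrival_rate M * share o s).

(* Social value of an outcome, queueing excluded, when each car trip is worth
   [D] before schedule delay. *)
Definition welfare (D : R) (o : outcome R) : R :=
  \int[leb]_(s in desired M)
    (arrival_rate M * (share o s * (D - delay_cost M (cross o s) s))).

Lemma slope_sum_gt0 : 0 < slope_sum M.
Proof. by rewrite addr_gt0 ?invr_gt0 ?earl_gt0 ?late_gt0. Qed.

Lemma desired_integrable (k : R) (f : R -> R) :
  measurable_fun (desired M) f -> (forall s, desired M s -> `|f s| <= k) ->
  leb.-integrable (desired M) (EFin \o f).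
Proof. by move=> mf fk; exact: (bounded_integrable_itv mf fk). Qed.

Lemma Rintegral_desired_cst (k : R) :
  \int[leb]_(s in desired M) k = k * (t2 M - t1 M).
Proof.
rewrite Rintegral_cst//.
rewrite /desired /= lebesgue_measure_itv/= lte_fin.
by case: hM => _ -> _ _ _.
Qed.

Lemma integrable_surplus (D k : R) :
  leb.-integrable (desired M) (EFin \o (fun s => k * surplus M D s)).
Proof.
pose b := earl M * `|early_end M D - t1 M| + late M * `|t2 M - late_start M D|.
apply: (@desired_integrable (`|k| * b)).
  by apply: measurable_funM => //; apply: measurable_funTS; exact: measurable_surplus.
move=> s; rewrite /desired/= in_itv/= => /andP[t1s st2].
rewrite normrM ler_wpM2l// ger0_norm ?surplus_ge0//.
apply: lerD; rewrite ler_wpM2l ?(ltW (earl_gt0 hM)) ?(ltW (late_gt0 hM))//.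
  have := ler_norm (early_end M D - t1 M); have := normr_ge0 (early_end M D - t1 M).
  by case: (pos_partP (early_end M D - s)) => -[-> ?]; lra.
have := ler_norm (t2 M - late_start M D); have := normr_ge0 (t2 M - late_start M D).
by case: (pos_partP (s - late_start M D)) => -[-> ?]; lra.
Qed.

Section Equilibrium.
Variables (tau : R -> R) (o : outcome R).
Hypotheses (tau0 : forall t, 0 <= tau t) (ho : equilibrium M tau o).

Lemma share_ge0 s : desired M s -> 0 <= share o s.
Proof. by move=> /(eq_share_itv ho)/andP[]. Qed.

Lemma share_le1 s : desired M s -> share o s <= 1.
Proof. by move=> /(eq_share_itv ho)/andP[]. Qed.

Lemma arrival_share_ge0 s : desired M s -> 0 <= arrival_rate M * share o s.
Proof. by move=> ds; rewrite mulr_ge0 ?share_ge0 ?(ltW (arrival_rate_gt0 hM hcap)). Qed.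

Lemma measurable_arrival_share :
  measurable_fun (desired M) (fun s => arrival_rate M * share o s).
Proof. by apply: measurable_funM => //; exact: eq_share_meas ho. Qed.

(** The time of arrival at the bottleneck is nondecreasing in the crossing time by
    first-in-first-out, hence measurable. *)
Lemma measurable_queue : measurable_fun setT (queue o).
Proof.
have -> : queue o = (fun t => t - (t - queue o t)).
  by apply/funext => t; ring.
apply: measurable_funB => //; apply: nondecreasing_measurable => //.
by move=> s t st; exact: (eq_fifo ho st).
Qed.

Lemma measurable_delay_cross :
  measurable_fun (desired M) (fun s => delay_cost M (cross o s) s).
Proof. by apply: measurable_delay_cost; exact: eq_cross_meas ho. Qed.

(** The factor [share o s] keeps the bound valid where nobody drives and [cross o s] is
    meaningless. *)
Lemma driver_cost s : desired M s ->
  share o s * (queue o (cross o s) + delay_cost M (cross o s) s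
               + tau (cross o s)) <= share o s * (zT M - zC M).
Proof.
move=> ds; have := share_ge0 ds; rewrite le_eqVlt => /predU1P[<-|s0].
  by rewrite !mul0r.
have [_] := eq_car ho ds s0; rewrite car_costE => h.
by rewrite ler_wpM2l ?(ltW s0)//; lra.
Qed.

Lemma share_mul_bound (f : R) s : desired M s -> 0 <= f ->
  share o s * f <= share o s * (zT M - zC M) ->
  `|arrival_rate M * (share o s * f)| <= arrival_rate M * `|zT M - zC M|.
Proof.
move=> ds f0 fle; have s0 := share_ge0 ds.
rewrite normrM (ger0_norm (ltW (arrival_rate_gt0 hM hcap))).
rewrite ler_wpM2l ?(ltW (arrival_rate_gt0 hM hcap))//.
rewrite ger0_norm ?mulr_ge0//; apply: (le_trans fle).
apply: (@le_trans _ _ (share o s * `|zT M - zC M|)).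
  by rewrite ler_wpM2l// ler_norm.
by rewrite ler_piMl// share_le1.
Qed.

(** Any nonnegative part of a driver's cost is bounded by the saving [zT M - zC M]. This serves for
    schedule delay, queueing and toll. *)
Lemma integrable_cost_part (f : R -> R) : measurable_fun (desired M) f ->
  (forall s, desired M s -> 0 <= f s) ->
  (forall s, desired M s -> f s <= queue o (cross o s)
               + delay_cost M (cross o s) s + tau (cross o s)) ->
  leb.-integrable (desired M)
    (EFin \o (fun s => arrival_rate M * (share o s * f s))).
Proof.
move=> mf f0 fle; apply: (@desired_integrable (arrival_rate M * `|zT M - zC M|)).
  apply: measurable_funM => //; apply: measurable_funM => //.
  exact: eq_share_meas ho.
move=> s ds; apply: share_mul_bound => //; first exact: f0.
apply: le_trans (driver_cost ds); rewrite ler_wpM2l ?share_ge0//.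
exact: fle.
Qed.

Lemma integrable_drivers :
  leb.-integrable (desired M) (EFin \o (fun s => arrival_rate M * share o s)).
Proof.
apply: (@desired_integrable (arrival_rate M)); first exact: measurable_arrival_share.
move=> s ds; rewrite ger0_norm ?arrival_share_ge0//.
by rewrite ler_piMr ?share_le1// (ltW (arrival_rate_gt0 hM hcap)).
Qed.

Lemma integrable_delay : leb.-integrable (desired M)
  (EFin \o (fun s => arrival_rate M * (share o s * delay_cost M (cross o s) s))).
Proof.
apply: integrable_cost_part; first exact: measurable_delay_cross.
  by move=> s _; exact: delay_cost_ge0.
move=> s _; have := eq_queue_ge0 ho (cross o s); have := tau0 (cross o s); lra.
Qed.

Lemma integrable_queue : leb.-integrable (desired M)
  (EFin \o (fun s => arrival_rate M * (share o s * queue o (cross o s)))).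
Proof.
apply: integrable_cost_part.
- exact: measurableT_comp measurable_queue (eq_cross_meas ho).
- by move=> s _; exact: eq_queue_ge0 ho _.
- move=> s _; have := delay_cost_ge0 hM (cross o s) s.
  by have := tau0 (cross o s); lra.
Qed.

Lemma welfareE D : welfare D o = D * drivers o
  - \int[leb]_(s in desired M)
      (arrival_rate M * (share o s * delay_cost M (cross o s) s)).
Proof.
rewrite /welfare /drivers -RintegralZl//; last first.
  exact: integrable_drivers.
rewrite -RintegralB//; last exact: integrable_delay.
  by apply: eq_Rintegral => s _; ring.
apply: (@desired_integrable (`|D| * arrival_rate M)).
  by apply: measurable_funM => //; exact: measurable_arrival_share.
move=> s ds; rewrite normrM ler_wpM2l// ger0_norm ?arrival_share_ge0//.
by rewrite ler_piMr ?share_le1// (ltW (arrival_rate_gt0 hM hcap)).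
Qed.

Lemma integrable_welfare D : leb.-integrable (desired M)
  (EFin \o (fun s =>
     arrival_rate M * (share o s * (D - delay_cost M (cross o s) s)))).
Proof.
pose f1 s := D * (arrival_rate M * share o s).
pose f2 s := arrival_rate M * (share o s * delay_cost M (cross o s) s).
rewrite (_ : EFin \o _ = ((EFin \o f1) \- (EFin \o f2))%E).
  apply: integrableB => //; last exact: integrable_delay.
  apply: (@desired_integrable (`|D| * arrival_rate M)).
    by apply: measurable_funM => //; exact: measurable_arrival_share.
  move=> s ds; rewrite normrM ler_wpM2l// ger0_norm ?arrival_share_ge0//.
  by rewrite ler_piMr ?share_le1// (ltW (arrival_rate_gt0 hM hcap)).
by apply/funext => s /=; rewrite -EFinB; congr EFin; rewrite /f1 /f2; ring.
Qed.

Lemma flow_integral (f : R -> R) :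
  measurable_fun setT f -> (forall t, 0 <= f t) ->
  (\int[leb]_t (rate o t * f t)%:E =
   \int[leb]_(s in desired M) (arrival_rate M * (share o s * f (cross o s)))%:E)%E.
Proof.
move=> mf f0.
under [RHS]eq_integral do rewrite mulrA.
apply: (@integral_pushforward_density _ _ _ _ _ leb leb (desired M) (cross o)
  (rate o) (fun s => arrival_rate M * share o s)) => //.
- exact: eq_cross_meas ho.
- exact: eq_rate_meas ho.
- exact: measurable_arrival_share.
- by move=> t; have /andP[] := eq_rate_itv ho t.
- exact: arrival_share_ge0.
- exact: eq_flow ho.
Qed.

Lemma flow_Rintegral_itv (f : R -> R) (a b : R) :
  measurable_fun setT f -> (forall t, 0 <= f t) ->
  (forall t, a <= t <= b \/ f t = 0) ->
  \int[leb]_(s in desired M) (arrival_rate M * (share o s * f (cross o s))) =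
  \int[leb]_(t in `[a, b]) (rate o t * f t).
Proof.
move=> mf f0 fab; rewrite /Rintegral -flow_integral//; congr fine.
rewrite [RHS]integral_mkcond; apply: eq_integral => t _.
rewrite patchE mem_setE in_itv/=.
by case: ifPn => // tab; case: (fab t) => [|->]; [rewrite (negbTE tab)|rewrite mulr0].
Qed.

End Equilibrium.
End Welfare.

(** * Weak duality and competitive outcomes *)

Section Duality.
Context {R : realType} (M : bottleneck R).
Hypotheses (hM : standing_assumptions M) (hcap : capacity M < arrival_rate M).
Local Notation leb := (@lebesgue_measure R).
Variable D : R.
Hypotheses (D0 : 0 <= D)
  (gapD : ratio M * D * slope_sum M <= t2 M - t1 M).
Local Notation o_trap := (trapezoid_outcome M D).

Let lam0 := ltW (arrival_rate_gt0 hM hcap).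

Lemma price_le t : price M D t <= D.
Proof.
have := surplus_ge0 hM D t; have := D0; rewrite /surplus /price => d0 h.
by case: (pos_partP (D - (earl M * Num.max (early_end M D - t) 0 +
  late M * Num.max (t - late_start M D) 0))) => -[-> ?]; lra.
Qed.

Lemma trapezoid_length : leb `[first_car M D, last_car M D]%classic =
  (last_car M D - first_car M D)%:E.
Proof.
have := early_end_late_start gapD.
have := first_car_le hM D0; have := le_last_car hM D0.
rewrite /= lebesgue_measure_itv/= lte_fin -EFinB.
by case: ltP => // lf ? ? ?; congr EFin; lra.
Qed.

Lemma integral_surplus : \int[leb]_(s in desired M) surplus M D s =
  (ratio M * D) ^+ 2 * slope_sum M / 2.
Proof.
have H1 := early_end_late_start gapD.
have H2 := t1_early_end hM hcap D0; have H3 := late_start_t2 hM hcap D0.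
have e0 := earl_gt0 hM; have l0 := late_gt0 hM.
have [||_ ->] := @Rintegral_two_ramps R (t1 M) (t2 M) (early_end M D)
  (late_start M D) (earl M) (late M).
- by apply/andP; split; lra.
- by apply/andP; split; lra.
- rewrite /early_end /late_start /slope_sum; field.
  by rewrite !gt_eqF.
Qed.

Lemma integral_price :
  leb.-integrable `[first_car M D, last_car M D] (EFin \o price M D) /\
  \int[leb]_(t in `[first_car M D, last_car M D]) price M D t =
  D * (t2 M - t1 M) + (1 - 2 * ratio M) * slope_sum M * D ^+ 2 / 2.
Proof.
have H1 := early_end_late_start gapD.
have H4 := first_car_le hM D0; have H5 := le_last_car hM D0.
have e0 := earl_gt0 hM; have l0 := late_gt0 hM.
have fl : first_car M D <= last_car M D by lra.
have [||ir rE] := @Rintegral_two_ramps R (first_car M D) (last_car M D)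
  (early_end M D) (late_start M D) (earl M) (late M).
- by apply/andP; split; lra.
- by apply/andP; split; lra.
have iD : leb.-integrable `[first_car M D, last_car M D] (EFin \o cst D).
  apply: (@bounded_integrable_itv _ _ _ `|D|) => //.
split.
  apply: (@bounded_integrable_itv _ _ _ D).
    by apply: measurable_funTS; exact: measurable_price.
  by move=> x _; rewrite ger0_norm ?price_ge0// price_le.
pose ramps t := earl M * Num.max (early_end M D - t) 0 +
  late M * Num.max (t - late_start M D) 0.
transitivity (\int[leb]_(t in `[first_car M D, last_car M D]) (D - ramps t)).
  apply: eq_Rintegral => t; rewrite mem_setE in_itv/= => tI.
  by rewrite (priceE hM D0 gapD).
rewrite (RintegralB _ iD ir)// rE Rintegral_cst//= trapezoid_length.
rewrite /first_car /last_car /= /early_end /late_start /slope_sum; field.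
by rewrite !gt_eqF.
Qed.

(** The objective of the dual program at the trapezoidal price is the function V of the overview. *)
Lemma dual_value :
  arrival_rate M * (\int[leb]_(s in desired M) surplus M D s) +
  capacity M * (\int[leb]_(t in `[first_car M D, last_car M D]) price M D t) =
  max_welfare M D.
Proof.
rewrite integral_surplus (proj2 integral_price) /max_welfare.
by have <- := arrival_rate_ratio hM hcap; field.
Qed.

Section Equilibrium.
Variables (tau : R -> R) (o : outcome R).
Hypotheses (tau0 : forall t, 0 <= tau t) (ho : equilibrium M tau o).

Lemma price_flow :
  \int[leb]_(s in desired M) (arrival_rate M * (share o s * price M D (cross o s)))
  = \int[leb]_(t in `[first_car M D, last_car M D]) (rate o t * price M D t).
Proof.
apply: (flow_Rintegral_itv hM hcap ho); first exact: measurable_price.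
  exact: price_ge0.
exact: (price_supp hM D0).
Qed.

Lemma integrable_price_cross : leb.-integrable (desired M)
  (EFin \o (fun s => arrival_rate M * (share o s * price M D (cross o s)))).
Proof.
apply: (@desired_integrable _ _ (arrival_rate M * D)).
  apply: measurable_funM => //; apply: measurable_funM; first exact: eq_share_meas ho.
  exact: measurableT_comp (measurable_price _ _) (eq_cross_meas ho).
move=> s ds; rewrite normrM (ger0_norm lam0) ler_wpM2l//.
rewrite ger0_norm ?mulr_ge0 ?price_ge0 ?(share_ge0 ho)//.
apply: le_trans (price_le (cross o s)).
by rewrite ler_piMl ?price_ge0// (share_le1 ho).
Qed.

Lemma integrable_rate_price :
  leb.-integrable `[first_car M D, last_car M D]
    (EFin \o (fun t => rate o t * price M D t)).
Proof.
apply: (@bounded_integrable_itv _ _ _ (capacity M * D)).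
  apply: measurable_funTS; apply: measurable_funM; first exact: eq_rate_meas ho.
  exact: measurable_price.
move=> t _; have /andP[r0 rm] := eq_rate_itv ho t.
by rewrite ger0_norm ?mulr_ge0 ?price_ge0// ler_pM ?price_ge0 ?price_le.
Qed.

(** Integrate [price_dual] against the share of drivers. The shares are at most 1, which bounds the
    rents; the price payments become an integral over crossing times, where the rate is at most the
    capacity. *)
Lemma weak_duality : welfare M D o <= max_welfare M D.
Proof.
rewrite -dual_value -(RintegralZl _ _ (proj1 integral_price))//.
rewrite -RintegralZl//; last first.
  by have := @integrable_surplus _ _ hM D 1; under eq_fun do rewrite mul1r.
apply: (@le_trans _ _ (\int[leb]_(s in desired M) (arrival_rate M * surplus M D s
   + arrival_rate M * (share o s * price M D (cross o s))))).
  apply: le_Rintegral => //.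
  - exact: (integrable_welfare hM hcap tau0 ho).
  - exact: (integrableD _ (integrable_surplus hM D _) integrable_price_cross).
  move=> s ds; rewrite -mulrDr ler_wpM2l//.
  have s0 := share_ge0 ho ds; have s1 := share_le1 ho ds.
  have := ler_wpM2l s0 (price_dual hM D (cross o s) s).
  have := ler_piMl (surplus_ge0 hM D s) s1.
  lra.
rewrite (RintegralD _ (integrable_surplus hM D _) integrable_price_cross)//.
rewrite lerD2l price_flow; apply: le_Rintegral => //.
- exact: integrable_rate_price.
- apply: (@bounded_integrable_itv _ _ _ (capacity M * D)).
    apply: measurable_funTS; apply: measurable_funM => //.
    exact: measurable_price.
  have c0 := ltW (capacity_gt0 hM).
  move=> t _; rewrite ger0_norm ?mulr_ge0 ?price_ge0//.
  by rewrite ler_wpM2l ?price_le.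
- move=> t _; rewrite ler_wpM2r ?price_ge0//.
  by have /andP[] := eq_rate_itv ho t.
Qed.

End Equilibrium.

(** Every inequality of weak duality is tight here: matches are tight, everybody with a positive
    rent drives, and the bottleneck runs at capacity wherever the price is positive. *)
Lemma trapezoid_welfare : welfare M D o_trap = max_welfare M D.
Proof.
have ho := trapezoid_equilibrium hM hcap D0 gapD.
rewrite -dual_value -(RintegralZl _ _ (proj1 integral_price))//.
rewrite -RintegralZl//; last first.
  by have := @integrable_surplus _ _ hM D 1; under eq_fun do rewrite mul1r.
transitivity (\int[leb]_(s in desired M) (arrival_rate M * surplus M D s
   + arrival_rate M * (share o_trap s * price M D (cross o_trap s)))).
  apply: eq_Rintegral => s /set_mem ds.
  have [_ cs] := cross_surplus hM hcap D0 gapD ds.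
  have sE : share o_trap s * surplus M D s = surplus M D s.
    rewrite /=; case: ifPn => [/andP[es sl]|_]; last by rewrite mul1r.
    have -> : surplus M D s = 0; last by rewrite mulr0.
    by rewrite /surplus !max_r ?subr_le0// !mulr0 addr0.
  by rewrite -sE -cs; ring.
rewrite (RintegralD _ (integrable_surplus hM D _) (integrable_price_cross ho))//.
rewrite (price_flow ho); congr (_ + _); apply: eq_Rintegral => t.
by rewrite mem_setE in_itv/= => ->.
Qed.

(** Flow conservation over the whole line counts the drivers as capacity times the length of the
    crossing interval. *)
Lemma trapezoid_drivers : drivers M o_trap =
  capacity M * (t2 M - t1 M + (1 - ratio M) * slope_sum M * D).
Proof.
have ho := trapezoid_equilibrium hM hcap D0 gapD.
have H1 := early_end_late_start gapD.
have H4 := first_car_le hM D0; have H5 := le_last_car hM D0.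
have := eq_flow ho measurableT; rewrite preimage_setT setIT.
rewrite /drivers /Rintegral => <-.
rewrite (_ : (\int[leb]_t (rate o_trap t)%:E)%E =
  (\int[leb]_(t in `[first_car M D, last_car M D]) (capacity M)%:E)%E); last first.
  rewrite [RHS]integral_mkcond; apply: eq_integral => t _.
  by rewrite patchE mem_setE in_itv/=; case: ifP.
rewrite integral_cst//= trapezoid_length.
rewrite /= /last_car /first_car /late_start /early_end /slope_sum; field.
by rewrite !gt_eqF ?earl_gt0 ?late_gt0.
Qed.

Section Competitive.
Variables (o : outcome R) (tau' : R -> R) (o' : outcome R).
Hypotheses (DG : D <= zT M - zC M)
  (ho : equilibrium M (cst (zT M - zC M - D)) o)
  (tau'0 : forall t, 0 <= tau' t) (ho' : equilibrium M tau' o').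

Let c0 (t : R) : 0 <= cst (zT M - zC M - D) t :> R.
Proof. by rewrite /= subr_ge0. Qed.

(* The queueing delays [queue o] act as competitive prices for capacity: no
   outcome gets more value out of the bottleneck at these prices. *)
Lemma competitive_share s : desired M s ->
  share o' s * (D - delay_cost M (cross o' s) s) <=
  share o s * (D - delay_cost M (cross o s) s - queue o (cross o s))
  + share o' s * queue o (cross o' s).
Proof.
move=> ds; set q := queue o (cross o s); set q' := queue o (cross o' s).
set d := delay_cost M (cross o s) s; set d' := delay_cost M (cross o' s) s.
have s0 := share_ge0 ho ds; have s1 := share_le1 ho ds.
have s'0 := share_ge0 ho' ds; have s'1 := share_le1 ho' ds.
suff : share o' s * (D - d' - q') <= share o s * (D - d - q) by lra.
(* If some users with desired time [s] take transit, then no crossing time is worth more to them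
   than its queueing delay. *)
have low : share o s < 1 -> D - d' - q' <= 0.
  by move=> lt1; have := eq_transit ho ds lt1 (cross o' s); rewrite car_costE/= -/d' -/q'; lra.
have [sp|sz] := ltP 0 (share o s); last first.
  have -> : share o s = 0 by apply/eqP; rewrite eq_le sz s0.
  by rewrite mul0r mulr_ge0_le0// low// (le_lt_trans sz).
have [opt part] := eq_car ho ds sp.
rewrite car_costE/= -/d -/q in part.
have := opt (cross o' s); rewrite !car_costE/= -/d -/d' -/q -/q' => le'.
have p0 : 0 <= D - d - q by lra.
have [lt1|ge1] := ltP (share o s) 1.
  by apply: (@le_trans _ _ 0); [rewrite mulr_ge0_le0 ?low|rewrite mulr_ge0].
have -> : share o s = 1 by apply/eqP; rewrite eq_le s1 ge1.
rewrite mul1r; apply: (@le_trans _ _ (share o' s * (D - d - q))).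
  by rewrite ler_wpM2l//; lra.
by rewrite ler_piMl.
Qed.

(** Over crossing times, both sides weigh the same delay [queue o] by a rate. Wherever this delay is
    positive, [o] discharges at capacity, which [o'] cannot exceed. The comparison is in extended
    reals because integrability of the left side is deduced from it. *)
Lemma queue_flow_le :
  (\int[leb]_(s in desired M) (arrival_rate M * (share o' s * queue o (cross o' s)))%:E
   <= \int[leb]_(s in desired M) (arrival_rate M * (share o s * queue o (cross o s)))%:E)%E.
Proof.
have mq := measurable_queue ho; have q0 := eq_queue_ge0 ho.
rewrite -(flow_integral hM hcap ho mq q0) -(flow_integral hM hcap ho' mq q0).
have rq (p : outcome R) tau : equilibrium M tau p ->
    measurable_fun setT (fun t => (rate p t * queue o t)%:E).
  by move=> hp; apply/measurable_EFinP/measurable_funM => //; exact: eq_rate_meas hp.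
apply: ge0_le_integral => //.
- by move=> t _; rewrite lee_fin mulr_ge0//; case/andP: (eq_rate_itv ho' t).
- exact: rq ho'.
- exact: rq ho.
- move=> t _; rewrite lee_fin; have := q0 t; rewrite le_eqVlt => /predU1P[<-|qt].
    by rewrite !mulr0.
  by rewrite ler_wpM2r// (eq_queue_capacity ho qt); case/andP: (eq_rate_itv ho' t).
Qed.

(** Integrating [competitive_share] leaves the difference of the two queue payments, which
    [queue_flow_le] shows to have the right sign. *)
Lemma competitive_welfare : welfare M D o' <= welfare M D o.
Proof.
have iq := integrable_queue hM hcap c0 ho.
have iw := integrable_welfare hM hcap c0 ho D.
have mq' : measurable_fun (desired M) (fun s => queue o (cross o' s)).
  exact: measurableT_comp (measurable_queue ho) (eq_cross_meas ho').
have f0 s : desired M s ->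
    0 <= arrival_rate M * (share o' s * queue o (cross o' s)).
  move=> ds; exact: (mulr_ge0 lam0 (mulr_ge0 (share_ge0 ho' ds) (eq_queue_ge0 ho _))).
have iq' : leb.-integrable (desired M)
    (EFin \o (fun s => arrival_rate M * (share o' s * queue o (cross o' s)))).
  apply/integrableP; split.
    apply/measurable_EFinP; apply: measurable_funM => //.
    by apply: measurable_funM => //; exact: eq_share_meas ho'.
  apply: le_lt_trans (integrable_lty _ iq) => //; apply: le_trans queue_flow_le.
  rewrite le_eqVlt; apply/orP; left; apply/eqP; apply: eq_integral.
  by move=> s /set_mem ds; rewrite /= ger0_norm// f0.
have q'q : \int[leb]_(s in desired M)
      (arrival_rate M * (share o' s * queue o (cross o' s))) <=
    \int[leb]_(s in desired M)
      (arrival_rate M * (share o s * queue o (cross o s))).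
  apply: fine_le; last exact: queue_flow_le; exact: integrable_fin_num.
pose f s := arrival_rate M * (share o s * (D - delay_cost M (cross o s) s)) -
            arrival_rate M * (share o s * queue o (cross o s)).
have if1 : leb.-integrable (desired M) (EFin \o f) by exact: (integrableB _ iw iq).
apply: (@le_trans _ _ (\int[leb]_(s in desired M)
   (f s + arrival_rate M * (share o' s * queue o (cross o' s))))).
  apply: le_Rintegral => //.
  - exact: (integrable_welfare hM hcap tau'0 ho').
  - exact: (integrableD _ if1 iq').
  move=> s ds; rewrite /f -mulrBr -mulrDr ler_wpM2l//.
  by have := competitive_share ds; lra.
rewrite (RintegralD _ if1 iq')// (RintegralB _ iw iq)//.
by rewrite /welfare; lra.
Qed.

End Competitive.
End Duality.

(** * Revenue and system cost *)

Section Revenue.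
Context {R : realType} (M : bottleneck R).
Hypotheses (hM : standing_assumptions M) (hcap : capacity M < arrival_rate M).
Local Notation leb := (@lebesgue_measure R).

Lemma revenue_cst (c : R) (o : outcome R) :
  0 <= c -> equilibrium M (cst c) o -> revenue M (cst c) o = c * drivers M o.
Proof.
move=> c0 ho; rewrite /revenue /drivers mulrC -RintegralZr//.
exact: (integrable_drivers hM hcap ho).
Qed.

(* The welfare maximum is differentiable in [D], and the number of drivers of
   any outcome attaining it at [D] is a subgradient there. *)
Lemma drivers_le (D : R) (o : outcome R) : 0 <= D -> D <= zT M - zC M ->
  ratio M * D * slope_sum M < t2 M - t1 M ->
  equilibrium M (cst (zT M - zC M - D)) o ->
  drivers M o <= capacity M * (t2 M - t1 M + (1 - ratio M) * slope_sum M * D).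
Proof.
move=> D0 DG gap ho; set T := t2 M - t1 M in gap *.
have c0 (t : R) : 0 <= cst (zT M - zC M - D) t :> R by rewrite /= subr_ge0.
have r0 := ratio_gt0 hM hcap; have r1 := ratio_lt1 hM hcap.
have H0 := slope_sum_gt0 hM; have m0 := capacity_gt0 hM.
set K := (1 - ratio M) * slope_sum M.
have K0 : 0 < K by rewrite mulr_gt0// subr_gt0.
(* The outcome attains V at [D], and its welfare at [D + e] is at most V there. Welfare is affine in
   [D] with slope the number of drivers, so this number is at most the difference quotient of V. *)
have le_shift e : 0 < e -> ratio M * (D + e) * slope_sum M <= T ->
    drivers M o <= capacity M * (T + K * D) + capacity M * K * e / 2.
  move=> e0 gape.
  have De0 : 0 <= D + e by lra.
  have up := weak_duality hM hcap De0 gape c0 ho.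
  have ho0 := trapezoid_equilibrium hM hcap D0 (ltW gap).
  have := competitive_welfare hM hcap DG ho c0 ho0.
  rewrite (trapezoid_welfare hM hcap D0 (ltW gap)) => low.
  move: up low; rewrite !(welfareE hM hcap c0 ho) /max_welfare -/T -/K.
  set N := drivers M o; set S := Rintegral _ _ _ => up low.
  rewrite -(ler_pM2l e0).
  have -> : e * (capacity M * (T + K * D) + capacity M * K * e / 2) =
    capacity M * (D + e) * T + capacity M * K * (D + e) ^+ 2 / 2 -
    (capacity M * D * T + capacity M * K * D ^+ 2 / 2) by field.
  lra.
apply/ler_addgt0Pr => d d0.
(* [e1] is the largest shift that keeps the peaks apart, positive by the strict gap; [e2] brings the
   quadratic error down to [d / 2]. *)
pose e1 := (T - ratio M * D * slope_sum M) / (ratio M * slope_sum M).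
pose e2 := d / (capacity M * K).
have rH0 : 0 < ratio M * slope_sum M by rewrite mulr_gt0.
have mK0 : 0 < capacity M * K by rewrite mulr_gt0.
have e10 : 0 < e1 by rewrite divr_gt0// subr_gt0.
have e20 : 0 < e2 by rewrite divr_gt0.
have e1E : ratio M * slope_sum M * e1 = T - ratio M * D * slope_sum M.
  by rewrite mulrC divfK// gt_eqF.
have e2E : capacity M * K * e2 = d by rewrite mulrC divfK// gt_eqF.
pose e := Num.min e1 e2.
have e0 : 0 < e by rewrite lt_min e10.
have le1 : ratio M * slope_sum M * e <= ratio M * slope_sum M * e1.
  by rewrite ler_pM2l// ge_min lexx.
have le2 : capacity M * K * e <= capacity M * K * e2.
  by rewrite ler_pM2l// ge_min lexx orbT.
apply: (le_trans (le_shift e e0 _)); first lra.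
lra.
Qed.

(** Under a constant toll revenue is proportional to the number of drivers, and the trapezoid
    attains the bound of [drivers_le]. *)
Lemma trapezoid_induced (D : R) : 0 <= D -> D <= zT M - zC M ->
  ratio M * D * slope_sum M < t2 M - t1 M ->
  Defs.induced M (cst (zT M - zC M - D)) (trapezoid_outcome M D).
Proof.
move=> D0 DG gap; have ho := trapezoid_equilibrium hM hcap D0 (ltW gap).
have c0 : 0 <= zT M - zC M - D by rewrite subr_ge0.
split=> // o' ho'; rewrite !revenue_cst// ler_wpM2l//.
rewrite (trapezoid_drivers hM hcap D0 (ltW gap)).
exact: drivers_le.
Qed.

Lemma trapezoid_revenue (D : R) : 0 <= D -> D <= zT M - zC M ->
  ratio M * D * slope_sum M < t2 M - t1 M ->
  revenue M (cst (zT M - zC M - D)) (trapezoid_outcome M D) =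
  (zT M - zC M - D) *
  (capacity M * (t2 M - t1 M + (1 - ratio M) * slope_sum M * D)).
Proof.
move=> D0 DG gap; have ho := trapezoid_equilibrium hM hcap D0 (ltW gap).
by rewrite revenue_cst// ?subr_ge0// (trapezoid_drivers hM hcap D0 (ltW gap)).
Qed.

Section Equilibrium.
Variables (tau : R -> R) (o : outcome R).
Hypotheses (mtau : measurable_fun setT tau) (tau0 : forall t, 0 <= tau t)
  (ho : equilibrium M tau o).

Let iq := integrable_queue hM hcap tau0 ho.
Let iw := integrable_welfare hM hcap tau0 ho (zT M - zC M).

(** The cost is measured from the situation where everybody takes transit: tolls cancel, and
    queueing is a pure loss. *)
Lemma system_costE : system_cost M tau o = mass M * zT M
  - (welfare M (zT M - zC M) o
     - \int[leb]_(s in desired M)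
         (arrival_rate M * (share o s * queue o (cross o s)))).
Proof.
have icst : leb.-integrable (desired M) (EFin \o cst (arrival_rate M * zT M)).
  by apply: (@desired_integrable _ M `|arrival_rate M * zT M|).
have -> : mass M * zT M = \int[leb]_(s in desired M) (arrival_rate M * zT M).
  by rewrite (Rintegral_desired_cst hM) -(mass_arrival hM); ring.
rewrite /welfare -(RintegralB _ iw iq)//.
rewrite -(RintegralB _ icst (integrableB _ iw iq))//.
apply: eq_Rintegral => s _; rewrite car_costE /=; ring.
Qed.

Lemma system_cost_ge_welfare :
  mass M * zT M - welfare M (zT M - zC M) o <= system_cost M tau o.
Proof.
rewrite system_costE.
suff : 0 <= \int[leb]_(s in desired M)
  (arrival_rate M * (share o s * queue o (cross o s))) by lra.
apply: Rintegral_ge0 => s ds.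
exact: (mulr_ge0 (ltW (arrival_rate_gt0 hM hcap))
  (mulr_ge0 (share_ge0 ho ds) (eq_queue_ge0 ho _))).
Qed.

(* A driver would otherwise pay [zT], so the toll is at most the saving. *)
Lemma system_cost_le_revenue :
  system_cost M tau o <= mass M * zT M - revenue M tau o.
Proof.
rewrite system_costE lerD2l lerN2 /welfare -(RintegralB _ iw iq)//.
have lam0 := ltW (arrival_rate_gt0 hM hcap).
apply: le_Rintegral => //.
- rewrite (_ : (fun _ => _) =
    (fun s => arrival_rate M * (share o s * tau (cross o s)))); last first.
    by apply/funext => s; rewrite mulrA.
  apply: (integrable_cost_part hM hcap ho) => //.
    exact: measurableT_comp mtau (eq_cross_meas ho).
  move=> s _; have := delay_cost_ge0 hM (cross o s) s.
  by have := eq_queue_ge0 ho (cross o s); lra.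
- exact: (integrableB _ iw iq).
- move=> s ds; rewrite -mulrA -mulrBr ler_wpM2l//.
  by have := driver_cost ho ds; lra.
Qed.

End Equilibrium.
End Revenue.

(** * Choice of the toll and conclusion *)

(** The bound says that twice V(G) exceeds the revenue at [D] by at most the mass times [G]. The
    witness maximizes the revenue [(G - D) * (T + K * D)], up to a constant factor, over nonnegative
    [D]. *)
Lemma two_approximation (R : realFieldType) (lam r T G K H : R) :
  0 < lam -> 0 < r -> r < 1 -> 0 < T -> 0 < H -> K = (1 - r) * H ->
  0 <= G -> r * G * H <= T ->
  exists D, [/\ 0 <= D, D <= G, r * D * H < T &
    2 * (lam * r * G * T + lam * r * K * G ^+ 2 / 2)
    - (G - D) * (lam * r * (T + K * D)) <= lam * T * G].
Proof.
move=> lam0 r0 r1 T0 H0 KE G0 gap.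
have K0 : 0 < K by rewrite KE mulr_gt0// subr_gt0.
(* Up to the factor [lam]: the drivers V'(G) do not outnumber the users. *)
have rKG : r * (T + K * G) <= T.
  have : (1 - r) * (r * G * H) <= (1 - r) * T by rewrite ler_wpM2l// subr_ge0 ltW.
  by rewrite KE; lra.
have [KGT|TKG] := leP (K * G) T.
  exists 0; split=> //; first by rewrite mulr0 mul0r.
  rewrite subr0 mulr0 addr0.
  have -> : 2 * (lam * r * G * T + lam * r * K * G ^+ 2 / 2) - G * (lam * r * T)
    = lam * G * (r * (T + K * G)) by field.
  by rewrite [leRHS]mulrAC ler_wpM2l// mulr_ge0// ltW.
pose D := (G - T / K) / 2.
have KD : 2 * (K * D) = K * G - T by rewrite /D; field; rewrite gt_eqF.
have TK0 : 0 < T / K by rewrite divr_gt0.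
have D0 : 0 <= D.
  by rewrite -(pmulr_rge0 _ K0); lra.
have DG : D < G by rewrite /D; lra.
have lr0 : 0 < lam * r by rewrite mulr_gt0.
exists D; split=> //; first exact: ltW.
  by apply: lt_le_trans gap; rewrite ltr_pM2r// ltr_pM2l.
(* Clearing denominators leaves a polynomial in [x = K * G] and [T]. After [2 * (K * D) = x - T] the
   revenue term is [(x + T) ^+ 2], and the inequality reduces to [0 <= (x - T) ^+ 2] and [rKG]. *)
rewrite -(ler_pM2l (_ : 0 < 4 * K)) ?mulr_gt0//.
set x := K * G in KD TKG rKG *.
have -> : 4 * K * (2 * (lam * r * G * T + lam * r * K * G ^+ 2 / 2)
    - (G - D) * (lam * r * (T + K * D))) =
  lam * (r * (8 * x * T + 4 * x ^+ 2 - (2 * x - 2 * (K * D)) * (2 * T + 2 * (K * D)))).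
  by rewrite /x; field.
have -> : 4 * K * (lam * T * G) = lam * (4 * x * T) by rewrite /x; ring.
rewrite ler_pM2l// KD.
apply: (@le_trans _ _ (r * (4 * x * (T + x)))).
  rewrite ler_pM2l//; have := sqr_ge0 (x - T); lra.
by rewrite mulrCA ler_wpM2l// mulr_ge0//; lra.
Qed.

Theorem theorem3 (R : realType) (M : bottleneck R)
    (tau_s tau_d : R -> R) (o_s o_d : outcome R) (SCmin : R)
    (hM : standing_assumptions M)
    (hz : 0 <= zC M <= zT M)
    (hcap : capacity M < arrival_rate M)
    (hs : revenue_optimal M (@static_tolls R) tau_s o_s)
    (hd : revenue_optimal M (@dynamic_tolls R) tau_d o_d)
    (hmin : is_min_system_cost M SCmin)
    (hgap : zT M - zC M
            <= mass M * earl M * late M / (capacity M * (earl M + late M))) :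
  system_cost M tau_d o_d <= 2 * SCmin /\
  system_cost M tau_s o_s <= 2 * SCmin.
Proof.
case/andP: hz => zC0 zCT; set G := zT M - zC M in hgap.
have G0 : 0 <= G by rewrite subr_ge0.
have e0 := earl_gt0 hM; have l0 := late_gt0 hM; have m0 := capacity_gt0 hM.
have lam0 := arrival_rate_gt0 hM hcap.
have T0 : 0 < t2 M - t1 M by rewrite subr_gt0; case: hM.
have mE := arrival_rate_ratio hM hcap.
(* This is [hgap] times [ratio M * slope_sum M], since [slope_sum M] is [(e + L) / (e * L)]. *)
have gap : ratio M * G * slope_sum M <= t2 M - t1 M.
  have k0 : 0 < ratio M * slope_sum M.
    by rewrite mulr_gt0 ?ratio_gt0 ?slope_sum_gt0.
  rewrite mulrAC; apply: (le_trans (ler_wpM2l (ltW k0) hgap)).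
  rewrite -(mass_arrival hM) /slope_sum /ratio le_eqVlt; apply/orP; left.
  apply/eqP; field; rewrite !gt_eqF// ?addr_gt0//.
have [D [D0 DG gapD approx]] := two_approximation lam0 (ratio_gt0 hM hcap)
  (ratio_lt1 hM hcap) T0 (slope_sum_gt0 hM) erefl G0 gap.
have opt := trapezoid_induced hM hcap D0 DG gapD.
have revE := trapezoid_revenue hM hcap D0 DG gapD.
have c0 : 0 <= zT M - zC M - D by rewrite subr_ge0.
have dyn : dynamic_tolls (cst (zT M - zC M - D)) by split.
have stat : static_tolls (cst (zT M - zC M - D)) by exists (zT M - zC M - D).
(* Queueing only adds to the cost, and weak duality at the full saving [G] bounds the rest. *)
have low : mass M * zT M - max_welfare M G <= SCmin.
  have [[tau [ o [[mtau tau0] [ho _] SCE]]] _] := hmin; rewrite -SCE.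
  apply: le_trans (system_cost_ge_welfare hM hcap tau0 ho).
  by rewrite lerD2l lerN2; exact: (weak_duality hM hcap G0 gap tau0 ho).
have mass0 : mass M * zT M = arrival_rate M * (t2 M - t1 M) * G + mass M * zC M.
  by rewrite -(mass_arrival hM) /G; ring.
have massC : 0 <= mass M * zC M.
  by have [M0 _ _ _ _] := hM; rewrite mulr_ge0// ltW.
(* The constant toll [G - D] competes in both classes of policies, so each optimal toll collects at
   least its revenue. The cost [mass M * zC M] is nonnegative and counts twice on the right, so it
   only helps. *)
have conclude (tau : R -> R) (o : outcome R) : measurable_fun setT tau -> (forall t, 0 <= tau t) ->
    equilibrium M tau o ->
    revenue M (cst (zT M - zC M - D)) (trapezoid_outcome M D) <= revenue M tau o ->
    system_cost M tau o <= 2 * SCmin.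
  move=> mtau tau0 ho rev.
  have up := system_cost_le_revenue hM hcap mtau tau0 ho.
  move: approx rev low; rewrite revE -/G /max_welfare mE; lra.
split.
  have [[mtau tau0] [ho _] best] := hd.
  by apply: conclude => //; exact: best.
have [[c c0' tauE] [ho _] best] := hs.
by apply: conclude => //; [rewrite tauE|rewrite tauE|exact: best].
Qed.
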